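(* Let $(X,d)$ be a metric space and let $T, f : X\rightarrow X$ be weakly compatible selfmaps satisfying property (E. A). Assume that $T$ is weakly contractive with respect to $f$. If $f(X)$ is closed (in $X$), then $f$ and $T$ have a unique common fixed point in $X$, i.e. there is exactly one $z\in X$ with $fz=Tz=z$.
   Context: $R_{+}=[0,\infty)$. $\Phi$ denotes the set of all continuous functions $\varphi:R_{+}\rightarrow R_{+}$ with $\varphi(0)=0$ and $\varphi(t)>0$ for $t>0$ (no monotonicity is required). A selfmap $T:X\rightarrow X$ is weakly contractive with respect to a selfmap $f:X\rightarrow X$ if there exists $\varphi\in\Phi$ such that for all $x,y\in X$, $d(Tx,Ty)\leq d(fx,fy)-\varphi(d(fx,fy))$. The pair $(f,T)$ is weakly compatible if $Tfx=fTx$ whenever $x\in X$ satisfies $fx=Tx$. The pair $(f,T)$ satisfies property (E. A) if there exists a sequence $\{x_{n}\}$ in $X$ such that $\lim_{n\to\infty}fx_{n}=\lim_{n\to\infty}Tx_{n}=t$ for some $t\in X$. *)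

(* Defs.v *)
From mathcomp Require Import all_boot all_order all_algebra.
From mathcomp Require Import all_classical all_reals all_analysis.

Set Implicit Arguments.
Unset Strict Implicit.
Unset Printing Implicit Defensive.

Import Order.TTheory GRing.Theory Num.Theory.
Import numFieldNormedType.Exports.

Local Open Scope classical_set_scope.
Local Open Scope ring_scope.

(* A map from R_+ to R_+ is represented by a total function on R of which only
   the values on [0, +oo[ are ever used; continuity is with respect to the
   subspace topology of [0, +oo[. *)
Definition Phi (R : realType) : set (R -> R) :=
  [set phi : R -> R | [/\ {within `[0, +oo[, continuous phi},
                 forall t : R, 0 <= t -> 0 <= phi t,
                 phi 0 = 0
               & forall t : R, 0 < t -> 0 < phi t]].

Definition weakly_contractive_wrt (R : realType) (X : metricType R)
    (T f : X -> X) : Prop :=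
  exists2 phi : R -> R, Phi phi &
    forall x y : X,
      mdist (T x) (T y) <= mdist (f x) (f y) - phi (mdist (f x) (f y)).

Definition weakly_compatible (X : Type) (f T : X -> X) : Prop :=
  forall x : X, f x = T x -> T (f x) = f (T x).

Definition property_EA (R : realType) (X : metricType R)
    (f T : X -> X) : Prop :=
  exists (x : nat -> X) (t : X),
    f (x n) @[n --> \oo] --> t /\ T (x n) @[n --> \oo] --> t.

(* Main.v *)
Require Import Defs.
From mathcomp Require Import all_boot all_order all_algebra.
From mathcomp Require Import all_classical all_reals all_analysis.

(** The contraction condition is used in two ways. Since [phi >= 0] it makes
    [T] nonexpansive relative to [f], so that if [f x_n --> f a] then
    [T x_n --> T a] ([cvg_nonexpansive_wrt]). Since [phi > 0] away from [0] it
    forces [f] to take a single value on all coincidence points, i.e. the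
    points with [f x = T x] ([coincidence_value_unique]).

    Let [t] be the common limit of [f x_n] and [T x_n] given by property (E.A).
    As [range f] is closed, [t = f a] for some [a]; then [T x_n] tends both to
    [T a] and to [t], so [T a = t = f a] and [a] is a coincidence point. By
    weak compatibility [t = f a] is a coincidence point too, so the uniqueness
    of the coincidence value gives [f t = f a = t], whence also [T t = t].
    A common fixed point is a coincidence point equal to its own value, so
    uniqueness of that value is also uniqueness of the fixed point. *)

Import Order.TTheory GRing.Theory Num.Theory.

Local Open Scope classical_set_scope.
Local Open Scope ring_scope.

Lemma weakly_contractive_nonexpansive {R : realType} {X : metricType R}
    {T f : X -> X} : weakly_contractive_wrt T f ->
  forall x y, mdist (T x) (T y) <= mdist (f x) (f y).
Proof.
move=> [phi [_ phi_ge0 _ _] Tf] x y; apply: (le_trans (Tf x y)).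
by rewrite gerBl phi_ge0// mdist_ge0.
Qed.

Lemma cvg_nonexpansive_wrt {R : realType} {X : metricType R} {I : Type}
    {F : set_system I} {FF : Filter F} {T f : X -> X} (x : I -> X) (a : X) :
  (forall x y, mdist (T x) (T y) <= mdist (f x) (f y)) ->
  f (x i) @[i --> F] --> f a -> T (x i) @[i --> F] --> T a.
Proof.
move=> Tf fx; apply/metricType_numDomainType.cvgrPdist_lt => e e0.
have fa_e : \forall i \near F, mdist (f a) (f (x i)) < e.
  exact: metricType_numDomainType.cvgr_dist_lt fx _ e0.
by apply: filterS fa_e => i; exact: le_lt_trans.
Qed.

(** At coincidence points the contraction condition reads
    [d <= d - phi d] with [d = mdist (f x) (f y)], which excludes [d > 0]. *)
Lemma coincidence_value_unique {R : realType} {X : metricType R}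
    {T f : X -> X} (x y : X) : weakly_contractive_wrt T f ->
  f x = T x -> f y = T y -> f x = f y.
Proof.
move=> [phi [_ _ _ phi_gt0] Tf] fTx fTy; apply/eqP/negP => /negP.
rewrite -mdist_gt0 => /phi_gt0; apply/negP; rewrite -leNgt.
by have := Tf x y; rewrite -fTx -fTy lerDl oppr_ge0.
Qed.

Theorem theorem3p1 (R : realType) (X : metricType R) (T f : X -> X)
    (hcompat : weakly_compatible f T)
    (hEA : property_EA f T)
    (hcontr : weakly_contractive_wrt T f)
    (hclosed : closed (range f)) :
  exists! z : X, f z = z /\ T z = z.
Proof.
have [x [t [fx_t Tx_t]]] := hEA.
have [a _ fa_t] : range f t.
  apply: (closed_cvg (range f)) fx_t => //.
  by apply: nearW => n; exists (x n).
have Ta_t : T a = t.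
  apply: (cvg_unique (@metric_hausdorff _ X)) Tx_t.
  apply: (cvg_nonexpansive_wrt _ _ (weakly_contractive_nonexpansive hcontr)).
  by rewrite fa_t.
have fTa : f a = T a by rewrite fa_t Ta_t.
have fTt : f t = T t by rewrite -{1}Ta_t -hcompat// fa_t.
have ft_t : f t = t.
  by rewrite -{2}fa_t; exact: coincidence_value_unique hcontr _ _.
exists t; split=> [|z [fz Tz]]; first by rewrite -fTt.
rewrite -ft_t -fz; apply: coincidence_value_unique hcontr fTt _.
by rewrite fz Tz.
Qed.
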